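(* For every maximal outerplanar graph $G$, $$\gamma(G) \leq \min\left\{3\rho(G),\ \tfrac{9}{4}\rho(G) + \tfrac{t}{4}\right\},$$ where $t$ is the number of vertices of degree at most $3$ in $G$.
   Context: All graphs are finite and simple. A graph is outerplanar if it has a plane embedding in which all vertices lie on the boundary of the unbounded face; it is maximal outerplanar if adding any new edge destroys outerplanarity. $\gamma(G)$ is the minimum size of a dominating set of $G$ (a set $X$ such that every vertex not in $X$ has a neighbor in $X$). A packing is a set of vertices with pairwise disjoint closed neighborhoods (equivalently, pairwise distance at least $3$); $\rho(G)$ is the maximum size of a packing. *)

(* Defs.v *)
From mathcomp Require Import all_boot all_order all_algebra.
From mathcomp Require Import all_classical all_reals all_analysis.

Set Implicit Arguments.
Unset Strict Implicit.
Unset Printing Implicit Defensive.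

Import Order.TTheory GRing.Theory Num.Theory.
Import numFieldNormedType.Exports.

Local Open Scope classical_set_scope.
Local Open Scope ring_scope.

(* A finite simple graph is a symmetric irreflexive relation [e : rel T] on a
   [T : finType]; these two properties are hypotheses of the results about [e]. *)

Section Graphs.
Variables (T : finType) (e : rel T).

Definition degree (x : T) : nat := #|[set y | e x y]%SET|.

Definition closed_nbh (x : T) : {set T} := [set y | (y == x) || e x y]%SET.

Definition dominating (X : {set T}) : bool :=
  [forall x, (x \notin X) ==> [exists y in X, e x y]].

(* The default [setT] of the minimisation is dominating. *)
Definition domination_number : nat :=
  #|[arg min_(X < [set: T]%SET | dominating X) #|X| ]|.

Definition packing (X : {set T}) : bool :=
  [forall x in X, forall y in X,
     (x != y) ==> [disjoint closed_nbh x & closed_nbh y]].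

Definition packing_number : nat := (\max_(X : {set T} | packing X) #|X|)%N.

Definition add_edge (x y : T) : rel T :=
  fun u v => e u v || ([set u; v]%SET == [set x; y]%SET).

End Graphs.

(* The edge [xy] is drawn as the Jordan arc [edge_arc x y] from [pos x] to [pos y],
   parametrised by [0, 1]; [edge_arc y x] is the same arc run backwards. The values
   [edge_arc x y] for non-adjacent [x], [y] are irrelevant. *)
Record plane_embedding (R : realType) (T : finType) (e : rel T) := PlaneEmbedding {
  pos : T -> R * R;
  edge_arc : T -> T -> R -> R * R;
  pos_inj : injective pos;
  arc_start : forall x y, e x y -> edge_arc x y 0 = pos x;
  arc_end : forall x y, e x y -> edge_arc x y 1 = pos y;
  arc_rev : forall x y, e x y -> forall s : R, s \in `[0, 1] ->
    edge_arc y x s = edge_arc x y (1 - s);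
  arc_continuous : forall x y, e x y -> {within `[0, 1], continuous (edge_arc x y)};
  arc_inj : forall x y, e x y -> {in `[0, 1] &, injective (edge_arc x y)};
  arc_avoids_vertices : forall x y z, e x y -> forall s : R, s \in `]0, 1[ ->
    edge_arc x y s <> pos z;
  arc_disjoint : forall x y x' y', e x y -> e x' y' ->
    [set x; y]%SET != [set x'; y']%SET ->
    forall s s' : R, s \in `]0, 1[ -> s' \in `]0, 1[ -> edge_arc x y s <> edge_arc x' y' s'
}.

Section Outerplanar.
Variables (R : realType) (T : finType).

Definition drawing (e : rel T) (D : plane_embedding R e) : set (R * R) :=
  range (pos D) `|`
  [set p | exists x y, e x y /\ exists2 s, s \in `[0, 1] & edge_arc D x y s = p].

Definition is_face (e : rel T) (D : plane_embedding R e) (F : set (R * R)) : Prop :=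
  exists2 z, (~` drawing D) z & F = connected_component (~` drawing D) z.

Definition boundary (A : set (R * R)) : set (R * R) := closure A `\` interior A.

Definition outerplanar (e : rel T) : Prop :=
  exists (D : plane_embedding R e) (F : set (R * R)),
    [/\ is_face D F, ~ bounded_set F & forall x, boundary F (pos D x)].

Definition maximal_outerplanar (e : rel T) : Prop :=
  outerplanar e /\
  forall x y, x != y -> ~~ e x y -> ~ outerplanar (add_edge e x y).

End Outerplanar.

(* Main.v *)
Require Import Defs.
From mathcomp Require Import all_boot zify.

(** An outerplanar graph even satisfies gamma <= 2 rho, which is below both bounds.

    Put a point z in the face that has all vertices on its boundary. Every vertex v can be joined
    to z by a curve meeting only arcs that end at v, so a K_4 minor of the graph would give a
    map of K_5 to the plane in which disjoint edges have disjoint images. This is impossible: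
    for disjoint edges ij and kl the difference of the two curves maps a square to the punctured
    plane, so its mod 2 winding number along the boundary of the square vanishes; in the sum
    over the 15 pairs of disjoint edges the contributions of vertex-edge pairs cancel, whereas
    the antipodal symmetry of p_i - p_k leaves an odd remainder.

    A graph without a K_4 minor has a vertex of degree at most 2; eliminating it (and joining its
    neighbours) creates no K_4 minor, so the graph has an elimination order of width 2. Greedily
    choosing packing vertices along this order, all conflicts of the chosen vertex can be
    dominated by two vertices. *)

Set Implicit Arguments.
Unset Strict Implicit.
Unset Printing Implicit Defensive.

(** * Graphs without a weak K4 *)

Section Graph.
Variable T : finType.
Implicit Types (e : rel T) (A B C S : {set T}) (x y v w : T).

Definition edges_in e A : rel T := [rel x y | [&& e x y, x \in A & y \in A]].

Definition connected_in e C := {in C &, forall x y, connect (edges_in e C) x y}.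

(* Weaker than a [K_4] minor: the [B i] need not be connected. *)
Definition weak_K4 e := exists (B : 'I_4 -> {set T}) (r : 'I_4 -> T),
  [/\ forall i, r i \in B i,
      forall i j, i != j -> [disjoint B i & B j]
    & forall i j, i != j -> connect (edges_in e (B i :|: B j)) (r i) (r j)].

Lemma edges_in_sym e A : symmetric e -> symmetric (edges_in e A).
Proof. by move=> es x y; rewrite /edges_in /= es [(x \in A) && _]andbC. Qed.

Lemma connect_edges_in_mem e A x y : connect (edges_in e A) x y -> x \in A -> y \in A.
Proof.
move=> /connectP[p]; elim: p x => [|z p IH] x /=; first by move=> _ ->.
by case/andP=> /and3P[_ _ zA] pz yl _; apply: IH pz yl zA.
Qed.

Definition eliminate e v : rel T :=
  [rel x y | [&& x != v, y != v & e x y || [&& x != y, e v x & e v y]]].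

Section Eliminate.
Variables (e : rel T) (v : T).
Hypotheses (e_sym : symmetric e) (e_irr : irreflexive e).

Lemma eliminate_sym : symmetric (eliminate e v).
Proof.
move=> x y; rewrite /eliminate /= e_sym [y == x]eq_sym.
by case: (x == v); case: (y == v) => //=; case: (e v x); rewrite ?andbF ?andbT //=.
Qed.

Lemma eliminate_irr : irreflexive (eliminate e v).
Proof. by move=> x; rewrite /eliminate /= e_irr eqxx !andbF. Qed.

Lemma weak_K4_eliminate : #|[set y | e v y]| <= 2 ->
  weak_K4 (eliminate e v) -> weak_K4 e.
Proof.
move=> dv [B [r [rB Bdis Bcon]]].
have rv i : r i != v.
  have [j ij] : exists j : 'I_4, i != j.
    by exists (if i == ord0 then ord_max else ord0); case: (eqVneq i ord0) => // ->.
  have /connectP[[|z p]] /= := Bcon i j ij.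
    move=> _ rr; have /pred0P/(_ (r i)) := Bdis i j ij.
    by rewrite /= rB -rr rB.
  by case/andP=> /and3P[/and3P[]].
have [x xN|N0] := pickP (e v); last first.
  exists B, r; split=> // i j ij; apply: connect_sub (Bcon i j ij) => a b.
  case/and3P=> /and3P[av bv]; rewrite !N0 ?andbF orbF => ab aA bA.
  by apply: connect1; rewrite /edges_in /= ab aA.
pose B' i := if x \in B i then v |: B i else B i :\ v.
have BB' i y : y != v -> (y \in B' i) = (y \in B i).
  by move=> yv; rewrite /B'; case: ifP; rewrite !inE (negbTE yv).
have vB' i : (v \in B' i) = (x \in B i).
  by rewrite /B'; case: ifP; rewrite !inE eqxx.
exists B', r; split=> [i|i j ij|i j ij].
- by rewrite BB'.
- apply/pred0P=> y /=; have [->|yv] := eqVneq y v.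
    by rewrite !vB'; apply: (pred0P (Bdis i j ij)).
  by rewrite !BB' //; apply: (pred0P (Bdis i j ij)).
- apply: connect_sub (Bcon i j ij) => a b.
  case/and3P=> /and3P[av bv /orP[ab|/and3P[ab va vb]]] aA bA.
    by apply: connect1; move: aA bA; rewrite /edges_in /= ab !inE !BB' // => -> ->.
  have xab : (x == a) || (x == b).
    apply: contraLR dv; rewrite negb_or -ltnNge => /andP[xa xb].
    apply: leq_trans (subset_leq_card (_ : x |: [set a; b] \subset _)).
      by rewrite cardsU1 cards2 !inE negb_or xa xb ab.
    by apply/subsetP=> y; rewrite !inE => /or3P[] /eqP->.
  have vA : v \in B' i :|: B' j.
    by rewrite inE !vB'; case/orP: xab => /eqP->; move: aA bA; rewrite !inE.
  have aA' : a \in B' i :|: B' j by move: aA; rewrite !inE !BB'.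
  have bA' : b \in B' i :|: B' j by move: bA; rewrite !inE !BB'.
  apply: (@connect_trans _ _ v); apply: connect1.
    by rewrite /edges_in /= e_sym va aA'.
  by rewrite /edges_in /= vb vA.
Qed.

Lemma connected_eliminate C : connected_in e C -> connected_in (eliminate e v) (C :\ v).
Proof.
move=> Ccon a b; rewrite !in_setD1 => /andP[av aC] /andP[bv bC].
pose e' := edges_in (eliminate e v) (C :\ v).
pose P c := if c == v then [exists c', [&& c' \in C, e v c' & connect e' a c']]
            else connect e' a c.
have Pa : P a by rewrite /P (negbTE av) connect0.
suff: P b by rewrite /P (negbTE bv).
have stepP c c' : P c -> edges_in e C c c' -> P c'.
  rewrite /P => Pc /and3P[ecc' cC c'C].
  case: eqP Pc => [cv /existsP[z /and3P[zC vz az]]|/eqP cv ac].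
    have c'v : c' != v by apply: contraTneq ecc' => ->; rewrite cv e_irr.
    rewrite (negbTE c'v); have [<-//|zc'] := eqVneq z c'.
    have zv : z != v by apply: contraTneq vz => ->; rewrite e_irr.
    apply: connect_trans az (connect1 _).
    by rewrite /e' /edges_in /eliminate /= !in_setD1 zv c'v zC c'C zc' vz -cv ecc' orbT.
  case: (eqVneq c' v) => [c'v|c'v].
    by apply/existsP; exists c; rewrite cC ac e_sym -c'v ecc'.
  apply: connect_trans ac (connect1 _).
  by rewrite /e' /edges_in /eliminate /= !in_setD1 cv c'v cC c'C ecc'.
have /connectP[p + ->] := Ccon a b aC bC.
by elim: p (a) Pa => [|z p IH] c //= Pc /andP[/(stepP _ _ Pc)]; apply: IH.
Qed.

End Eliminate.
End Graph.

Section LongestPath.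
Variables (T : finType) (e : rel T).
Hypotheses (e_sym : symmetric e) (e_irr : irreflexive e).
Implicit Types (x y v : T) (w s : seq T).

Lemma connect_edges_in_nth x0 w (A : {set T}) a b : sorted e w -> a <= b < size w ->
  (forall m, a <= m <= b -> nth x0 w m \in A) ->
  connect (edges_in e A) (nth x0 w a) (nth x0 w b).
Proof.
move=> ew; elim: b => [|b IH] /andP[ab bw] wA.
  by have -> : a = 0 by lia.
have [<-//|ab'] := eqVneq a b.+1.
apply: connect_trans (IH _ _) (connect1 _); first by lia.
  by move=> m /andP[am mb]; apply: wA; lia.
rewrite /edges_in /= !wA; try lia; rewrite andbT.
by move/(sortedP x0): ew => /(_ b bw) ->.
Qed.

Definition reverse_prefix i w := rev (take i w) ++ drop i w.

Lemma nth_reverse_prefix x0 i w m : i <= size w ->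
  nth x0 (reverse_prefix i w) m = nth x0 w (if m < i then i.-1 - m else m).
Proof.
move=> iw; rewrite nth_cat size_rev size_takel //; case: ltnP => mi.
  rewrite nth_rev size_takel // nth_take; last by lia.
  by congr nth; lia.
by rewrite nth_drop subnKC.
Qed.

Lemma size_reverse_prefix i w : size (reverse_prefix i w) = size w.
Proof. by rewrite size_cat size_rev -size_cat cat_take_drop. Qed.

Lemma perm_reverse_prefix i w : perm_eq (reverse_prefix i w) w.
Proof. by rewrite -{2}(cat_take_drop i w) perm_cat2r perm_rev. Qed.

Lemma sorted_reverse_prefix x0 w i : 0 < i < size w -> sorted e w ->
  e (nth x0 w 0) (nth x0 w i) -> sorted e (reverse_prefix i w).
Proof.
move=> /andP[i0 iw] /(sortedP x0) ew w0i; apply/(sortedP x0) => m.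
rewrite size_reverse_prefix => mw; rewrite !nth_reverse_prefix; try lia.
case: (ltnP m.+1 i) => mi; rewrite ?(ltnW mi).
  have -> : i.-1 - m = (i.-1 - m.+1).+1 by lia.
  by rewrite e_sym; apply: ew; lia.
case: ltnP => mi'; last exact: ew.
have -> : m = i.-1 by lia.
by rewrite subnn prednK.
Qed.

Lemma weak_K4_of_chords x0 w i j b : sorted e w -> uniq w ->
  1 < i -> i < j < size w -> i < b < size w ->
  e (nth x0 w 0) (nth x0 w i) -> e (nth x0 w 0) (nth x0 w j) ->
  e (nth x0 w i.-1) (nth x0 w b) -> weak_K4 e.
Proof.
move=> ew uw i1 /andP[ij jw] /andP[ib bw] e0i e0j eib.
pose lo := nth 0 [:: 0; i.-1; i; i.+1]; pose hi := nth 0 [:: i.-1; i; i.+1; size w].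
pose B (k : 'I_4) := [set y in w | lo k <= index y w < hi k].
have nB k m : m < size w -> (nth x0 w m \in B k) = (lo k <= m < hi k).
  by move=> mw; rewrite inE mem_nth //= index_uniq.
have sub (k l : 'I_4) m : m < size w -> (lo k <= m < hi k) || (lo l <= m < hi l) ->
    nth x0 w m \in B k :|: B l.
  by move=> mw; rewrite inE !nB.
exists B, (fun k => nth x0 w (lo k)); split.
- by move=> [[|[|[|[|k]]]] //= lk]; rewrite nB /lo /hi /=; lia.
- move=> k l kl; apply/pred0P => y /=; apply/negbTE; rewrite !inE.
  apply: contraNN kl => /andP[/andP[_ yk] /andP[_ yl]]; move: yk yl.
  case: k l => [[|[|[|[|k]]]] //= lk] [[|[|[|[|l]]]] //= ll]; rewrite /lo /hi //=; lia.
have csym C := sym_connect_sym (@edges_in_sym _ e C e_sym).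
suff H (k l : 'I_4) : k < l ->
    connect (edges_in e (B k :|: B l)) (nth x0 w (lo k)) (nth x0 w (lo l)).
  move=> k l kl; case: (ltngtP k l) => [/H//|/H|/val_inj kl'].
    by rewrite csym setUC.
  by rewrite kl' eqxx in kl.
have seg (k' l' : 'I_4) a c : a <= c < size w ->
    (forall m, a <= m <= c -> (lo k' <= m < hi k') || (lo l' <= m < hi l')) ->
    connect (edges_in e (B k' :|: B l')) (nth x0 w a) (nth x0 w c).
  move=> ac H; apply: connect_edges_in_nth => // m mac; apply: sub; [lia|exact: H].
have edge (k' l' : 'I_4) a c : a < size w -> c < size w -> e (nth x0 w a) (nth x0 w c) ->
    (lo k' <= a < hi k') || (lo l' <= a < hi l') ->
    (lo k' <= c < hi k') || (lo l' <= c < hi l') ->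
    connect (edges_in e (B k' :|: B l')) (nth x0 w a) (nth x0 w c).
  by move=> aw cw eac ha hc; apply: connect1; rewrite /edges_in /= eac !sub.
move: k l => [[|[|[|[|k]]]] //= lk] [[|[|[|[|l]]]] //= ll] // _; rewrite /lo /=.
- by apply: seg => [|m]; rewrite /lo /hi /=; lia.
- by apply: edge => //; rewrite /lo /hi /=; lia.
- apply: (@connect_trans _ _ (nth x0 w j)); first by apply: edge => //; rewrite /lo /hi /=; lia.
  by rewrite csym; apply: seg => [|m]; rewrite /lo /hi /=; lia.
- by apply: seg => [|m]; rewrite /lo /hi /=; lia.
- apply: (@connect_trans _ _ (nth x0 w b)); first by apply: edge => //; rewrite /lo /hi /=; lia.
  by rewrite csym; apply: seg => [|m]; rewrite /lo /hi /=; lia.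
- by apply: seg => [|m]; rewrite /lo /hi /=; lia.
Qed.

(* Among all longest paths [w] take one whose shortest chord [w_0 w_i] at its first vertex is
   as short as possible. Reversing the prefix before [w_i] gives a longest path starting
   at [w_(i-1)], so both [w_0] and [w_(i-1)] have a neighbour beyond [w_i]. *)
Lemma weak_K4_of_degree_ge3 (S : {set T}) x :
  (forall x y, e x y -> y \in S) -> x \in S ->
  {in S, forall v, 2 < #|[set y | e v y]|} -> weak_K4 e.
Proof.
move=> eS xS deg3.
pose ok w := [&& sorted e w, uniq w & all (mem S) w].
have [n] : {n | [exists w : n.-tuple T, ok w] /\
    forall m, [exists w : m.-tuple T, ok w] -> m <= n}.
  have ex1 : exists m, [exists w : m.-tuple T, ok w].
    by exists 1; apply/existsP; exists [tuple x]; rewrite /ok /= xS.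
  have le m : [exists w : m.-tuple T, ok w] -> m <= #|T|.
    case/existsP=> w /and3P[_ /card_uniqP + _].
    by rewrite size_tuple => <-; apply: max_card.
  by case: (ex_maxnP ex1 le) => m Pm mP; exists m.
case=> exn maxn.
have {}maxn w : ok w -> size w <= n.
  by move=> okw; apply: maxn; apply/existsP; exists (in_tuple w).
have n0 : 0 < n by apply: (maxn [:: x]); rewrite /ok /= xS.
have nbr w y : ok w -> size w = n -> e (nth x w 0) y -> y \in w.
  case: w => [|z w] okw sw /= ezy; first by rewrite -sw in n0.
  apply: contraT => yw; have := maxn (y :: z :: w).
  rewrite -sw /= ltnn; apply; move: okw; rewrite /ok /= => /and3P[-> /andP[-> ->] /andP[-> ->]].
  by rewrite e_sym ezy yw (eS _ _ ezy).
have chord w i : ok w -> size w = n ->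
    (forall m, 1 < m < n -> e (nth x w 0) (nth x w m) -> i <= m) ->
    exists2 j, i < j < n & e (nth x w 0) (nth x w j).
  move=> okw sw imin.
  have [/existsP[j /andP[ij ej]]|H] :=
    boolP [exists j : 'I_n, (i < j) && e (nth x w 0) (nth x w j)].
    by exists j; rewrite ?ij /=.
  have w0S : nth x w 0 \in S.
    by case/and3P: okw => _ _ /allP; apply; apply: mem_nth; rewrite sw.
  suff : #|[set y | e (nth x w 0) y]| <= 2 by rewrite leqNgt deg3.
  apply: leq_trans (subset_leq_card (_ : _ \subset [set nth x w 1; nth x w i])) _; last first.
    by rewrite cards2; case: eqP.
  apply/subsetP=> y; rewrite !inE => e0y.
  have yw := nbr _ _ okw sw e0y.
  have iy : index y w < n by rewrite -sw index_mem.
  move: e0y; rewrite -(nth_index x yw); set m := index y w in iy * => e0m.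
  have m0 : m != 0 by apply: contraTneq e0m => ->; rewrite e_irr.
  have [->|m1] := eqVneq m 1; first by rewrite eqxx.
  have im : i <= m by apply: imin => //; lia.
  have [->|mi] := eqVneq m i; first by rewrite eqxx orbT.
  by case/existsP: H; exists (Ordinal iy); rewrite /= e0m andbT; lia.
pose Q i := [exists w : n.-tuple T, [&& ok w, 1 < i < n & e (nth x w 0) (nth x w i)]].
have exQ : exists i, Q i.
  case/existsP: exn => w okw.
  have [|j j1 ej] := @chord w 1 okw (size_tuple w); first by move=> m /andP[/ltnW].
  by exists j; apply/existsP; exists w; rewrite okw j1 ej.
case: (ex_minnP exQ) => i /existsP[w /and3P[okw /andP[i1 iN] e0i]] imin.
have sw : size w = n by apply: size_tuple.
have minw (u : seq T) : ok u -> size u = n ->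
    forall m, 1 < m < n -> e (nth x u 0) (nth x u m) -> i <= m.
  move=> oku su m m1 em; apply: imin; apply/existsP; rewrite -su in m1 *.
  by exists (in_tuple u); rewrite oku m1 em.
have [j ij ej] := chord w i okw sw (minw w okw sw).
have [ew uw aw] := and3P okw.
pose u := reverse_prefix i w.
have oku : ok u.
  rewrite /ok (sorted_reverse_prefix _ ew e0i) ?sw; last by lia.
  rewrite (perm_uniq (perm_reverse_prefix i w)) uw.
  by rewrite (perm_all _ (perm_reverse_prefix i w)).
have su : size u = n by rewrite size_reverse_prefix.
have [b /andP[ib bn]] := chord u i oku su (minw u oku su).
rewrite !nth_reverse_prefix ?sw; try lia.
rewrite subn0 (ltnW i1) ltnNge (ltnW ib) /= => eb.
by apply: (weak_K4_of_chords ew uw i1 _ _ e0i ej eb); rewrite sw // ib.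
Qed.

End LongestPath.

Section EliminationOrder.
Variable T : finType.
Implicit Types (e : rel T) (s : seq T) (A C S W D P : {set T}) (v w x y : T).

Definition later_nbh e k s C := [set w | (w \notin take k s) && [exists c in C, e c w]].

(* Treewidth at most two, read off an elimination order [s]. *)
Definition narrow e s := forall k C, {subset C <= take k s} -> connected_in e C ->
  #|later_nbh e k s C| <= 2.

Lemma narrow_cons e v s : symmetric e -> irreflexive e ->
  #|[set y | e v y]| <= 2 -> narrow (eliminate e v) s -> narrow e (v :: s).
Proof.
move=> e_sym e_irr dv ns [|k] C Cs Ccon.
  rewrite (_ : later_nbh _ _ _ _ = set0) ?cards0 //.
  by apply/setP=> w; rewrite !inE /=; apply/negbTE/existsP => -[c /andP[/Cs]].
have [/existsP[c /andP[cC cv]]|/existsPn Cv] := boolP [exists c in C, c != v]; last first.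
  apply: leq_trans (subset_leq_card _) dv; apply/subsetP=> w.
  rewrite !inE => /andP[_ /existsP[c /andP[cC ecw]]].
  by have := Cv c; rewrite cC negbK => /eqP <-.
have C's : {subset C :\ v <= take k s}.
  by move=> x; rewrite in_setD1 => /andP[xv /Cs]; rewrite inE (negbTE xv).
apply: leq_trans (ns k _ C's (connected_eliminate e_sym e_irr Ccon)).
apply: subset_leq_card; apply/subsetP=> w; rewrite !inE negb_or.
move=> /andP[/andP[wv ws] /existsP[z /andP[zC ezw]]]; rewrite ws /=.
have [zv|zv] := eqVneq z v; last first.
  by apply/existsP; exists z; rewrite in_setD1 zv zC /eliminate /= zv wv ezw.
rewrite {z}zv in zC ezw.
have /connectP[[|y p] /=] := Ccon v c zC cC; first by move=> _ cv'; rewrite cv' eqxx in cv.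
case/andP=> /and3P[evy _ yC] _ _.
have yv : y != v by apply: contraTneq evy => ->; rewrite e_irr.
apply/existsP; exists y; rewrite in_setD1 yv yC /eliminate /= yv wv evy ezw !andbT.
apply/orP; right; apply: contraNneq ws => <-.
by apply: C's; rewrite in_setD1 yv.
Qed.

Lemma narrow_order e S : symmetric e -> irreflexive e ->
  (forall x y, e x y -> y \in S) -> ~ weak_K4 e ->
  exists s, [/\ uniq s, s =i S & narrow e s].
Proof.
elim: #|S| {-2}S (leqnn #|S|) e => [|n IH] {}S Sn e e_sym e_irr eS noK4.
  have S0 : S = set0 by apply/eqP; rewrite -cards_eq0; lia.
  exists [::]; split=> // [x|k C Cs _]; first by rewrite S0 inE.
  rewrite (_ : later_nbh _ _ _ _ = set0) ?cards0 //.
  by apply/setP=> w; rewrite !inE /=; apply/negbTE/existsP => -[c /andP[/Cs]].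
have [S0|[x xS]] := set_0Vmem S; first by apply: IH => //; rewrite S0 cards0.
have [v vS dv] : exists2 v, v \in S & #|[set y | e v y]| <= 2.
  have [/existsP[v /andP[vS dv]]|/existsPn H] := boolP [exists v in S, #|[set y | e v y]| <= 2].
    by exists v.
  case: noK4; apply: (weak_K4_of_degree_ge3 e_sym e_irr eS xS) => v vS.
  by have := H v; rewrite vS /= -ltnNge.
have [|x' y||s [us sS ns]] := IH (S :\ v) _ _ (eliminate_sym v e_sym) (eliminate_irr v e_irr).
- by move: Sn; rewrite (cardsD1 v) vS.
- rewrite /eliminate in_setD1 => /and3P[_ -> /orP[/eS//|/and3P[_ _ /eS//]]].
- by apply: contra_not noK4; apply: weak_K4_eliminate.
exists (v :: s); split.
- by rewrite /= us sS in_setD1 eqxx.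
- by move=> y; rewrite inE sS in_setD1; case: eqVneq => [->|].
- exact: narrow_cons.
Qed.

Lemma component_connected_in e A x : symmetric e -> x \in A ->
  connected_in e [set y | connect (edges_in e A) x y].
Proof.
move=> e_sym xA; set C := [set y | _].
have H y : connect (edges_in e A) x y -> connect (edges_in e C) x y.
  case/connectP=> p + ->; elim/last_ind: p => [|p z IH] //.
  rewrite rcons_path last_rcons => /andP[px /[dup] lz /and3P[elz _ _]].
  apply: connect_trans (IH px) (connect1 _).
  have xl : connect (edges_in e A) x (last x p) by apply/connectP; exists p.
  by rewrite /edges_in /= elz !inE xl (connect_trans xl (connect1 lz)).
move=> y z; rewrite !inE => /H xy /H xz.
apply: connect_trans xz.
by rewrite (sym_connect_sym (@edges_in_sym _ e C e_sym)).
Qed.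

Section Greedy.
Variables (e : rel T) (s : seq T).
Hypotheses (e_sym : symmetric e) (sT : forall x, x \in s) (ns : narrow e s).

Local Notation N := (closed_nbh e).

Lemma in_closed_nbh x : x \in N x. Proof. by rewrite inE eqxx. Qed.

Lemma closed_nbhC x y : (x \in N y) = (y \in N x).
Proof. by rewrite !inE eq_sym e_sym. Qed.

(* Let [k] be the least index of a last vertex of a [N w], for [w] in [W]. If some [p] in [W] comes
   before [k], the at most two later neighbours of the component of [p] below [k] hit [N w]
   for every [w] in [W] in conflict with [p]. Otherwise [k] is the index of some [v] in [W],
   the conflicts of [v] are among [v] and the at most two later neighbours of [N v],
   and each of the latter has a common neighbour with [v]. *)
Lemma greedy_step W : W != set0 -> exists2 p, p \in W &
  exists2 D : {set T}, #|D| <= 2 &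
  {in W, forall w, ~~ [disjoint N w & N p] -> ~~ [disjoint N w & D]}.
Proof.
case/set0Pn=> w0 w0W.
pose top w := \max_(x in N w) index x s.
case: (arg_minnP top w0W) => v vW0; set k := top v => kmin.
have vW : v \in W by exact: vW0.
have lek x : x \in N v -> index x s <= k by apply: (@leq_bigmax_cond _ (fun x => x \in N v)).
have gek w : w \in W -> exists2 z, z \in N w & k <= index z s.
  move=> /kmin kw; have [|z zN E] := @eq_bigmax_cond _ (mem (N w)) (fun x => index x s).
    by apply/card_gt0P; exists w; apply: in_closed_nbh.
  by exists z => //; rewrite -E.
have tk m x : (x \in take m s) = (index x s < m) by apply: in_take.
have [/existsP[p /andP[pW pk]]|/existsPn nok] := boolP [exists p in W, index p s < k].
  exists p => //.
  pose A : {set T} := [set x in take k s]; pose C := [set y | connect (edges_in e A) p y].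
  have pA : p \in A by rewrite inE tk.
  have CA : {subset C <= take k s}.
    by move=> y; rewrite inE => /connect_edges_in_mem/(_ pA); rewrite inE.
  exists (later_nbh e k s C); first exact/ns/component_connected_in.
  have Cstep x y : x \in C -> e x y -> y \notin later_nbh e k s C -> y \in C.
    move=> xC exy; rewrite inE negb_and negbK => /orP[yk|]; last first.
      by move/existsPn/(_ x); rewrite xC exy.
    move: (xC); rewrite !inE => px; apply: connect_trans px (connect1 _).
    by rewrite /edges_in /= exy !inE (CA _ xC) yk.
  have NC x y : x \in C -> y \in N x -> y \notin later_nbh e k s C -> y \in C.
    by move=> xC; rewrite inE => /orP[/eqP->|] //; apply: Cstep.
  move=> w wW /pred0Pn[y /= /andP[yw yp]].
  apply: contraT => /negbNE /pred0P dis.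
  have {}dis d : d \in N w -> d \notin later_nbh e k s C.
    by move=> dw; have := dis d; rewrite /= dw /= => ->.
  have yC : y \in C by apply: (NC p) => //; [rewrite inE | apply: dis].
  have wC : w \in C by apply: (NC y) => //; [rewrite closed_nbhC | apply/dis/in_closed_nbh].
  have [z zw] := gek w wW.
  by have /CA := NC w z wC zw (dis z zw); rewrite tk ltnNge => /negbTE->.
have vk : index v s = k.
  by apply/eqP; rewrite eqn_leq lek ?in_closed_nbh //=; have := nok v; rewrite /= vW -leqNgt.
have Ck : {subset N v <= take k.+1 s} by move=> x xv; rewrite tk ltnS lek.
have Ccon : connected_in e (N v).
  have H x : x \in N v -> connect (edges_in e (N v)) v x.
    move=> xv; move: (xv); rewrite inE => /orP[/eqP->//|evx].
    by apply: connect1; rewrite /edges_in /= evx xv in_closed_nbh.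
  move=> x y /H vx /H; apply: connect_trans.
  by rewrite (sym_connect_sym (@edges_in_sym _ e _ e_sym)).
have := ns Ck Ccon; set L := later_nbh _ _ _ _ => L2.
have conflict w : w \in W -> ~~ [disjoint N w & N v] -> w != v -> w \in L.
  move=> wW /pred0Pn[y /= /andP[yw yv]] wv.
  have wk : w \notin take k.+1 s.
    rewrite tk -leqNgt; have := nok w; rewrite /= wW -leqNgt leq_eqVlt -vk.
    by case/orP=> // /eqP /(congr1 (nth v s)); rewrite !nth_index // => vw; rewrite vw eqxx in wv.
  rewrite inE wk; apply/existsP; exists y; rewrite yv.
  move: yw; rewrite inE => /orP[/eqP yw|]; last by rewrite e_sym.
  by move: wk; rewrite -yw Ck.
exists v => //; have [L0|[a aL]] := set_0Vmem L.
  exists [set v]; rewrite ?cards1 // => w wW cw; apply/pred0Pn; exists w.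
  rewrite /= in_closed_nbh inE; apply: contraT => wv.
  by have := conflict w wW cw wv; rewrite L0 inE.
move: (aL); rewrite inE => /andP[_ /existsP[y /andP[yv eya]]].
exists (y |: L :\ a).
  by move: L2; rewrite (cardsD1 a) aL cardsU1; case: (_ \notin _); lia.
move=> w wW cw; apply/pred0Pn; have [->|wv] := eqVneq w v.
  by exists y; rewrite /= yv !inE eqxx.
have [->|wa] := eqVneq w a; first by exists y; rewrite /= !inE eqxx e_sym eya orbT.
by exists w; rewrite /= in_closed_nbh in_setU1 in_setD1 wa (conflict w) ?orbT.
Qed.

Lemma greedy_packing W : exists P D : {set T},
  [/\ P \subset W, packing e P, {in W, forall w, ~~ [disjoint N w & D]} & #|D| <= 2 * #|P|].
Proof.
elim: #|W| {-2}W (leqnn #|W|) => [|n IH] {}W Wn.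
  exists set0, set0; rewrite sub0set cards0; split=> //.
    by apply/forallP=> x; rewrite inE.
  have -> : W = set0 by apply/eqP; rewrite -cards_eq0; lia.
  by move=> w; rewrite inE.
have [->|Wn0] := eqVneq W set0; first by apply: (IH set0); rewrite cards0.
have [p pW [D0 D02 hit]] := greedy_step Wn0.
have [|P [D [PW Ppack hitD D2P]]] := IH [set w in W | [disjoint N w & N p]].
  rewrite -ltnS; apply: leq_trans Wn; apply: proper_card; apply/properP; split.
    by apply/subsetP=> w; rewrite inE => /andP[].
  by exists p => //; rewrite inE pW /= -setI_eq0 setIid;
    apply/set0Pn; exists p; apply: in_closed_nbh.
have Pp w : w \in P -> [disjoint N w & N p].
  by move/(subsetP PW); rewrite inE => /andP[].
exists (p |: P), (D0 :|: D); split.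
- apply/subsetP=> w; rewrite !inE => /orP[/eqP->//|/(subsetP PW)].
  by rewrite inE => /andP[].
- apply/forallP=> x; apply/implyP=> xP; apply/forallP=> y; apply/implyP=> yP.
  apply/implyP=> xy; move: xP yP; rewrite !inE.
  case/orP=> [/eqP xp|xP] /orP[/eqP yp|yP].
  + by rewrite xp yp eqxx in xy.
  + by rewrite xp disjoint_sym Pp.
  + by rewrite yp Pp.
  + by move/forallP: Ppack => /(_ x); rewrite xP => /forallP/(_ y); rewrite yP xy.
- move=> w wW; rewrite -setI_eq0 setIUr setU_eq0 !setI_eq0 negb_and.
  have [dw|/(hit w wW)->//] := boolP [disjoint N w & N p].
  by rewrite hitD ?orbT // inE wW.
- have pP : p \notin P.
    apply/negP=> /Pp; rewrite -setI_eq0 setIid => /eqP E.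
    by have := in_closed_nbh p; rewrite E inE.
  by rewrite cardsU1 pP mulnDr; apply: leq_trans (leq_card_setU _ _) _; lia.
Qed.

Lemma domination_le_2packing : domination_number e <= 2 * packing_number e.
Proof.
have [P [D [_ Pp hit D2P]]] := greedy_packing [set: T].
apply: leq_trans (leq_trans D2P _); last first.
  by rewrite leq_mul2l; apply: (@leq_bigmax_cond _ (packing e) (fun X : {set T} => #|X|)).
rewrite /domination_number; case: arg_minnP => [|X _]; last apply.
  by apply/forallP=> x; rewrite inE.
apply/forallP=> x; apply/implyP=> xD.
have /pred0Pn[y /= /andP[]] := hit x (in_setT x).
rewrite inE => /orP[/eqP-> yD|exy yD]; first by rewrite yD in xD.
by apply/existsP; exists y; rewrite yD.
Qed.
End Greedy.
End EliminationOrder.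

From mathcomp Require Import all_boot all_order all_algebra.
From mathcomp Require Import all_classical all_reals all_analysis.
From mathcomp Require Import lra zify.

Import Order.TTheory GRing.Theory Num.Theory.
Import numFieldNormedType.Exports.

Local Open Scope ring_scope.

(** * Chains in the plane *)

Lemma even_addb8 (a b c d a' b' c' d' : bool) :
  (a (+) b) (+) (c (+) d) = (a' (+) b') (+) (c' (+) d') ->
  exists m, (a + b + c + d + a' + b' + c' + d' = 2 * m)%N.
Proof.
move=> E; exists (a + b + c + d + a' + b' + c' + d')./2%N.
rewrite mul2n even_halfK // !oddD !oddb.
by move: E; case: a b c d a' b' c' d' => [] [] [] [] [] [] [] [].
Qed.

Section Crossing.
Variable R : realDomainType.
Implicit Types (u v p q x y : R * R) (X Y : seq (R * R)) (d : R).

Definition close d p q := (`|p.1 - q.1| < d) && (`|p.2 - q.2| < d).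

(* The tie on the axis is broken so that exactly one of [u] and [- u] is below, for [u] nonzero. *)
Definition below u := (u.2 < 0) || (u.2 == 0) && (u.1 < 0).

(* Whether the step from [u] to [v] crosses the ray of positive abscissae, provided that it is
   short compared with the norm of [u]. *)
Definition crosses u v := (below u (+) below v) && (0 < u.1).

Lemma below_opp p q : p != q -> below (p - q) = ~~ below (q - p).
Proof.
case: p q => [p1 p2] [q1 q2]; rewrite xpair_eqE /below /= => pq.
rewrite !subr_lt0 !subr_eq0.
by move: pq; case: (ltrgtP p2 q2); case: (ltrgtP p1 q1).
Qed.

Lemma close_sym d p q : close d p q = close d q p.
Proof. by rewrite /close distrC [X in _ && (X < _)]distrC. Qed.

Lemma below_lt0 u : u.2 < 0 -> below u.
Proof. by rewrite /below => ->. Qed.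

Lemma below_gt0 u : 0 < u.2 -> below u = false.
Proof. by rewrite /below; case: ltrgtP. Qed.

(* The factor 3 puts the four differences in a common half-plane bounded by an axis. *)
Lemma crosses_cell d x x' y y' : 0 < d -> ~~ close (3 * d) x y ->
  close d x x' -> close d y y' ->
  crosses (y - x) (y' - x) (+) crosses (y - x') (y' - x') =
  crosses (y - x) (y - x') (+) crosses (y' - x) (y' - x').
Proof.
move=> d0 far /andP[]; rewrite !ltr_norml => /andP[l1 l2] /andP[l3 l4].
move=> /andP[]; rewrite !ltr_norml => /andP[l5 l6] /andP[l7 l8].
move: far; rewrite /close negb_and -!leNgt !ler_normr /crosses.
case/orP=> /orP[] far.
- have [-> -> ->] : [/\ 0 < (y - x).1 = false, 0 < (y - x').1 = false
                     & 0 < (y' - x).1 = false].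
    by split; apply/negbTE; rewrite -leNgt /=; lra.
  by rewrite !andbF.
- have [-> -> ->] : [/\ 0 < (y - x).1, 0 < (y - x').1 & 0 < (y' - x).1].
    by split => /=; lra.
  by rewrite !andbT; do 4 case: (below _).
- do 4 ![rewrite below_lt0 /=; last lra]; by [].
- do 4 ![rewrite below_gt0 /=; last lra]; by [].
Qed.

Lemma crosses_opp d x x' y : 0 < d -> ~~ close (3 * d) x y -> close d x x' ->
  crosses (y - x) (y - x') =
  crosses (x - y) (x' - y) (+) (below (x - y) (+) below (x' - y)).
Proof.
move=> d0 far cl.
have [xy xy'] : x != y /\ x' != y.
  split; apply: contraNneq far; rewrite /close.
    by move=> ->; rewrite !subrr normr0 mulr_gt0.
  by move=> <-; case/andP: cl => c1 c2; apply/andP; split; lra.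
rewrite /crosses (below_opp xy) (below_opp xy').
case/andP: cl; rewrite !ltr_norml => /andP[l1 l2] /andP[l3 l4].
move: far; rewrite /close negb_and -!leNgt !ler_normr.
case/orP=> /orP[] far.
- have [-> ->] : 0 < (y - x).1 = false /\ 0 < (x - y).1.
    by split => /=; try (apply/negbTE; rewrite -leNgt /=); lra.
  by rewrite ?andbF ?andbT; do 2 case: (below _).
- have [-> ->] : 0 < (y - x).1 /\ 0 < (x - y).1 = false.
    by split => /=; try (apply/negbTE; rewrite -leNgt /=); lra.
  by rewrite ?andbF ?andbT; do 2 case: (below _).
- do 2 ![rewrite below_lt0 /=; last lra]; by [].
- do 2 ![rewrite below_gt0 /=; last lra]; by [].
Qed.

Fixpoint crossings p y Y :=
  if Y is y' :: Y' then crosses (y - p) (y' - p) (+) crossings p y' Y'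
  else false.

Definition far d (x : R * R) X y Y :=
  all (fun a => all (fun b => ~~ close (3 * d) a b) (y :: Y)) (x :: X).

Lemma crossings_strip d x x' y Y : 0 < d -> close d x x' ->
  path (close d) y Y -> far d x [::] y Y -> far d x' [::] y Y ->
  crossings x y Y (+) crossings x' y Y =
  crosses (y - x) (y - x') (+) crosses (last y Y - x) (last y Y - x').
Proof.
move=> d0 xx'; elim: Y y => [|y' Y IH] y /=; first by rewrite addbb.
move=> /andP[yy' pY]; rewrite /far /= !andbT => /and3P[f1 f2 f3] /and3P[g1 g2 g3].
have := IH y' pY; rewrite /far /= !andbT f2 f3 g2 g3 => /(_ isT isT).
have := crosses_cell d0 f1 xx' yy'.
move: (crossings x y' Y) (crossings x' y' Y) => a b.
move: (crosses (last _ _ - _) _) (crosses (y - x) _) (crosses (y - x') _).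
move: (crosses (y - x) _) (crosses (y' - x) _).
by case: a b; case; case; case; case; case; case.
Qed.

(* The difference map [(s, t) |-> Y t - X s] does not vanish on the square, so its mod 2
   crossing number with the ray along the boundary of the square is zero; on two
   of the sides it is the opposite of the vectors counted by [crossings]. *)
Lemma crossings_square d x X y Y : 0 < d ->
  path (close d) x X -> path (close d) y Y -> far d x X y Y ->
  crossings x y Y (+) crossings (last x X) y Y
    (+) (crossings y x X (+) crossings (last y Y) x X) =
  below (x - y) (+) below (last x X - y)
    (+) (below (x - last y Y) (+) below (last x X - last y Y)).
Proof.
move=> d0; elim: X x => [|x' X IH] x /=.
  by move=> _ _ _; rewrite !addbb.
move=> /andP[xx' pX] pY /andP[f1 f2].
have f3 : far d x' [::] y Y by move: f2 => /= /andP[f2 _]; rewrite /far /= andbT.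
have := IH x' pX pY f2.
have f1' : far d x [::] y Y by rewrite /far /= andbT.
have := crossings_strip d0 xx' pY f1' f3.
rewrite (crosses_opp d0 _ xx'); last by case/andP: f1.
rewrite (crosses_opp d0 _ xx'); last first.
  by move/allP: f1; apply; rewrite mem_last.
move: (crossings x y Y) (crossings x' y Y) => a b.
move=> /(canRL (addbK _))-> /(canRL (addbK _)) /(canRL (addKb _))->.
do 2 move: (crosses _ _) (crossings _ _ _).
move: (below _) (below _) (below _) (below _) (below _) (below _).
by case: b; do 10 case.
Qed.

Lemma van_kampen_flores_chains d (p : nat -> R * R)
    (L : nat -> nat -> seq (R * R)) : 0 < d ->
  (forall i j, (i < j < 5)%N -> path (close d) (p i) (L i j) /\ last (p i) (L i j) = p j) ->
  (forall i j k l, (i < j < 5)%N -> (k < l < 5)%N -> (i < k)%N -> uniq [:: i; j; k; l] ->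
     far d (p i) (L i j) (p k) (L k l)) -> False.
Proof.
move=> d0 Lp Lfar.
pose c i k l : nat := crossings (p i) (p k) (L k l).
pose b i j : nat := below (p i - p j).
have key i j k l : (i < j < 5)%N -> (k < l < 5)%N -> (i < k)%N -> uniq [:: i; j; k; l] ->
  exists m, (c i k l + c j k l + c k i j + c l i j + b i k + b j k + b i l + b j l = 2 * m)%N.
  move=> ij kl ik u; have [pij lij] := Lp _ _ ij; have [pkl lkl] := Lp _ _ kl.
  have := crossings_square d0 pij pkl (Lfar _ _ _ _ ij kl ik u).
  by rewrite lij lkl; apply: even_addb8.
have bC i j : p i != p j -> (b j i = 1 - b i j)%N.
  by move=> pij; rewrite /b (below_opp pij); case: below.
have pD i j k l : (i < j < 5)%N -> (k < l < 5)%N -> (i < k)%N -> uniq [:: i; j; k; l] ->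
  p k != p j /\ p l != p j.
  move=> ij kl ik u; have [_ lij] := Lp _ _ ij; have [_ lkl] := Lp _ _ kl.
  have := Lfar _ _ _ _ ij kl ik u.
  move=> /allP/(_ (p j)); rewrite -lij mem_last lij => /(_ isT)/allP fj.
  split; [have:= fj (p k) (mem_head _ _)|have:= fj (p l)].
    by apply: contraNneq => ->; rewrite /close !subrr normr0 mulr_gt0.
  rewrite -{1}lkl mem_last => /(_ isT).
  by apply: contraNneq => ->; rewrite /close !subrr normr0 mulr_gt0.
have b1 i j : (b i j <= 1)%N by rewrite /b; case: below.
have b21 := bC _ _ (@pD 0 2 1 3 isT isT isT isT).1%N.
have b31 := bC _ _ (@pD 0 3 1 2 isT isT isT isT).1%N.
have b41 := bC _ _ (@pD 0 4 1 2 isT isT isT isT).1%N.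
have b32 := bC _ _ (@pD 0 3 2 4 isT isT isT isT).1%N.
have b42 := bC _ _ (@pD 0 4 2 3 isT isT isT isT).1%N.
have b43 := bC _ _ (@pD 0 4 1 3 isT isT isT isT).2%N.
have := (b1 1 2)%N; have := (b1 1 3)%N; have := (b1 1 4)%N.
have := (b1 2 3)%N; have := (b1 2 4)%N; have := (b1 3 4)%N.
have [] := (key 0 1 2 3 isT isT isT isT)%N; have [] := (key 0 1 2 4 isT isT isT isT)%N.
have [] := (key 0 1 3 4 isT isT isT isT)%N; have [] := (key 0 2 1 3 isT isT isT isT)%N.
have [] := (key 0 2 1 4 isT isT isT isT)%N; have [] := (key 0 2 3 4 isT isT isT isT)%N.
have [] := (key 0 3 1 2 isT isT isT isT)%N; have [] := (key 0 3 1 4 isT isT isT isT)%N.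
have [] := (key 0 3 2 4 isT isT isT isT)%N; have [] := (key 0 4 1 2 isT isT isT isT)%N.
have [] := (key 0 4 1 3 isT isT isT isT)%N; have [] := (key 0 4 2 3 isT isT isT isT)%N.
have [] := (key 1 2 3 4 isT isT isT isT)%N; have [] := (key 1 3 2 4 isT isT isT isT)%N.
have [] := (key 1 4 2 3 isT isT isT isT)%N.
clear key b1 pD bC Lp Lfar.
rewrite {}b21 {}b31 {}b41 {}b32 {}b42 {}b43.
lia.
Qed.
End Crossing.

(** * Outerplanar drawings *)

Section Plane.
Local Open Scope classical_set_scope.
Local Open Scope ring_scope.
Variable R : realType.
Implicit Types (p q z : R * R) (A B K O : set (R * R)) (d : R).

Lemma closeP d p q : reflect (ball p d q) (close d p q).
Proof. by apply: (iffP andP) => -[]. Qed.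

Lemma open_ballP O : (forall p, O p -> exists2 d, 0 < d & forall q, close d p q -> O q) -> open O.
Proof.
move=> H; rewrite openE => p /H[d d0 Hd].
by apply/nbhs_ballP; exists d => // q /closeP; apply: Hd.
Qed.

Lemma open_close O p : open O -> O p -> exists2 d, 0 < d & forall q, close d p q -> O q.
Proof.
rewrite openE => oO /oO /nbhs_ballP[d d0 Hd].
by exists d => // q /closeP; apply: Hd.
Qed.

Lemma close_refl d p : 0 < d -> close d p p.
Proof. by move=> d0; rewrite /close !subrr !normr0 d0. Qed.

Lemma close_trans d p q z : close (d / 2) p q -> close (d / 2) q z -> close d p z.
Proof.
rewrite /close !ltr_norml => /andP[/andP[a1 a2] /andP[a3 a4]] /andP[/andP[b1 b2] /andP[b3 b4]].
by apply/andP; split; apply/andP; split; lra.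
Qed.

Lemma open_thickening A d : open [set q | exists2 p, A p & close d p q].
Proof.
rewrite (_ : [set q | _] = \bigcup_(p in A) [set q | close d p q]); last first.
  by apply/seteqP; split=> q [p Ap]; exists p.
apply: bigcup_open => p _; apply: open_ballP => q /= /andP[c1 c2].
have m0 : 0 < Num.min (d - `|p.1 - q.1|) (d - `|p.2 - q.2|) by rewrite lt_min !subr_gt0 c1.
exists (Num.min (d - `|p.1 - q.1|) (d - `|p.2 - q.2|)) => // z.
rewrite /close !lt_min => /andP[/andP[h1 _] /andP[_ h2]].
apply/andP; split.
  have := ler_distD q.1 p.1 z.1; lra.
have := ler_distD q.2 p.2 z.2; lra.
Qed.

Lemma clopen_partition A O1 O2 : connected A -> open O1 -> open O2 ->
  A `<=` O1 `|` O2 -> A `&` O1 `&` O2 = set0 -> A `&` O1 !=set0 -> A `<=` O1.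
Proof.
move=> Acon o1 o2 A12 dis ne p Ap.
have AE : A `&` O1 = A `&` ~` O2.
  apply/seteqP; split=> q [Aq Oq]; split=> //.
    by move=> O2q; have : set0 q by rewrite -dis.
  by case: (A12 q Aq).
have := Acon _ ne (ex_intro2 _ _ O1 o1 erefl).
move=> /(_ (ex_intro2 _ _ (~` O2) (open_closedC o2) AE)) E.
by move: Ap; rewrite -E => -[].
Qed.

Definition linked d A p q :=
  exists s, [/\ path (close d) p s, last p s = q & forall x, x \in s -> A x].

Lemma linked_trans d A p q z : linked d A p q -> linked d A q z -> linked d A p z.
Proof.
move=> [s [ps ls As]] [t [qt lt At]]; exists (s ++ t); split.
- by rewrite cat_path ps ls.
- by rewrite last_cat ls.
- by move=> x; rewrite mem_cat => /orP[/As|/At].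
Qed.

Lemma linked_sub d A B p q : A `<=` B -> linked d A p q -> linked d B p q.
Proof. by move=> AB [s [ps ls As]]; exists s; split=> // x /As/AB. Qed.

Lemma connected_linked d A p q : 0 < d -> connected A -> A p -> A q -> linked d A p q.
Proof.
move=> d0 Acon Ap Aq.
pose B := [set x | A x /\ linked d A p x].
have Bstep x y : B x -> A y -> close d x y -> B y.
  move=> [Ax px] Ay xy; split=> //; apply: linked_trans px _.
  by exists [:: y]; split=> //= [|z]; [rewrite xy | rewrite inE => /eqP->].
suff : A `<=` [set q | exists2 p, B p & close d p q].
  by move=> /(_ q Aq)[x Bx xq]; case: (Bstep x q Bx Aq xq).
apply: (clopen_partition (O2 := [set q | exists2 p, (A `\` B) p & close d p q]) Acon).
- exact: open_thickening.
- exact: open_thickening.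
- move=> x Ax; have [Bx|nBx] := EM (B x); [left|right]; exists x => //; exact: close_refl.
- rewrite -subset0 => x [[Ax [y By yx]] [y' [Ay' nBy'] y'x]]; apply: nBy'.
  by apply: Bstep (Bstep _ _ By Ax yx) Ay' _; rewrite close_sym.
- by exists p; split=> //; exists p; [split=> //; exists [::]|exact: close_refl].
Qed.

Definition segment p q : set (R * R) :=
  (fun t : R => (p.1 + t * (q.1 - p.1), p.2 + t * (q.2 - p.2))) @` `[0, 1].

Lemma segment_cont p q :
  continuous (fun t : R => (p.1 + t * (q.1 - p.1), p.2 + t * (q.2 - p.2))).
Proof.
have affine (a b : R) : continuous (fun t : R => a + t * b).
  by move=> t; apply: cvgD; [exact: cvg_cst|apply: cvgM; [exact: cvg_id|exact: cvg_cst]].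
move=> t; apply: (cvg_pair (G := nbhs (p.1 + t * (q.1 - p.1)))
  (H := nbhs (p.2 + t * (q.2 - p.2)))); exact: affine.
Qed.

Lemma compact_segment p q : compact (segment p q).
Proof.
apply: continuous_compact; last exact: segment_compact.
exact/continuous_subspaceT/segment_cont.
Qed.

Lemma connected_segment p q : connected (segment p q).
Proof.
apply: connected_continuous_connected; first exact: segment_connected.
exact/continuous_subspaceT/segment_cont.
Qed.

Lemma segment_left p q : segment p q p.
Proof. by exists 0; rewrite ?mul0r ?addr0 -?surjective_pairing //= in_itv /= lexx ler01. Qed.

Lemma segment_right p q : segment p q q.
Proof.
exists 1; first by rewrite /= in_itv /= lexx ler01.
by rewrite !mul1r ![_ + (_ - _)]addrC !subrK -surjective_pairing.
Qed.

Lemma segment_close d p q z : close d p q -> segment p q z -> close d p z.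
Proof.
move=> /andP[c1 c2] [t]; rewrite /= in_itv /= => /andP[t0 t1] <-.
rewrite /close /= !opprD !addrA !subrr !sub0r !normrN !normrM (ger0_norm t0).
by rewrite !(le_lt_trans (ler_piMl _ t1)) // distrC.
Qed.

Definition joined O p q := exists K, [/\ compact K, connected K, K `<=` O, K p & K q].

Lemma joined_trans O p q z : joined O p q -> joined O q z -> joined O p z.
Proof.
move=> [K [cK nK KO Kp Kq]] [L [cL nL LO Lq Lz]]; exists (K `|` L); split.
- exact: compactU.
- by apply: connectedU => //; exists q.
- by move=> x [/KO|/LO].
- by left.
- by right.
Qed.

Lemma joined_sym O p q : joined O p q -> joined O q p.
Proof. by move=> [K [cK nK KO Kp Kq]]; exists K. Qed.

Lemma joined_segment O p q : segment p q `<=` O -> joined O p q.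
Proof.
by move=> sO; exists (segment p q); split;
  [exact: compact_segment|exact: connected_segment| |exact: segment_left|exact: segment_right].
Qed.

Lemma connected_joined O A p q : open O -> A `<=` O -> connected A -> A p -> A q -> joined O p q.
Proof.
move=> oO AO Acon Ap Aq.
have near_joined x : O x -> exists2 d, 0 < d & forall y, close d x y -> joined O x y.
  move=> Ox; have [d d0 dO] := open_close oO Ox; exists d => // y xy.
  by apply: joined_segment => z /(segment_close xy); apply: dO.
suff /(_ q Aq)[] : A `<=` [set x | O x /\ joined O p x] by [].
apply: (clopen_partition (O2 := [set x | O x /\ ~ joined O p x]) Acon).
- apply: open_ballP => x [Ox px]; have [d d0 dj] := near_joined x Ox; exists d => // y xy.
  have jxy := dj y xy; split; last exact: joined_trans px jxy.
  by have [K [_ _ KO _ Ky]] := jxy; apply: KO.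
- apply: open_ballP => x [Ox px]; have [d d0 dj] := near_joined x Ox; exists d => // y xy.
  have jxy := dj y xy; split; first by have [K [_ _ KO _ Ky]] := jxy; apply: KO.
  by move=> py; apply: px; apply: joined_trans py (joined_sym jxy).
- by move=> x Ax; have [j|j] := EM (joined O p x); [left|right]; split=> //; apply: AO.
- by rewrite -subset0 => x [[_ [_ ?]] []].
- exists p; split=> //; split; first exact: AO.
  by apply: joined_segment => x [t _ <-]; rewrite !subrr !mulr0 !addr0 -surjective_pairing; apply: AO.
Qed.

Lemma compact_closed_plane A : compact A -> closed A.
Proof.
have haus : hausdorff_space (R * R)%type := @norm_hausdorff R (R * R)%type.
exact: compact_closed.
Qed.

Lemma compact_apart A B : compact A -> compact B -> A `&` B = set0 ->
  \forall d \near 0^'+, forall p q, A p -> B q -> ~~ close (3 * d) p q.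
Proof.
move=> /compact_near_coveringP cA cB AB.
have cBo : open (~` B) by apply: closed_openC; apply: compact_closed_plane.
have apart : \forall d \near 0^'+, A `<=` [set p | forall q, B q -> ~~ close (3 * d) p q].
  apply: cA => p Ap.
  have [|r r0 Br] := open_close (p := p) cBo; first by move=> Bp; rewrite -[False]/(set0 p) -AB.
  exists ([set x | close (r / 2) p x], [set d | d < r / 6]).
    split; first by apply/nbhs_ballP; exists (r / 2) => [|x /closeP//] /=; rewrite divr_gt0.
    by apply: nbhs_right_lt; rewrite divr_gt0.
  move=> [x d] /= [px dr] q Bq; apply/negP => xq; apply: (Br q _ Bq).
  apply: close_trans px _; case/andP: xq => c1 c2; apply/andP; split; lra.
by apply: filterS apart => d H p q Ap Bq; apply: (H p Ap q Bq).
Qed.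
End Plane.

Section Drawing.
Local Open Scope classical_set_scope.
Local Open Scope ring_scope.
Variables (R : realType) (T : finType) (e : rel T) (D : plane_embedding R e).
Hypothesis e_irr : irreflexive e.
Implicit Types (p q : R * R) (x y v w : T).

Definition arc x y : set (R * R) := edge_arc D x y @` `[0, 1].

Definition piece x y : set (R * R) :=
  if x == y then [set pos D x] else if e x y then arc x y else set0.

Lemma compact_piece x y : compact (piece x y).
Proof.
rewrite /piece; case: ifP => _; first exact: compact_set1.
case: ifP => [exy|_]; last exact: compact0.
apply: continuous_compact; [exact: arc_continuous|exact: segment_compact].
Qed.

Lemma connected_arc x y : e x y -> connected (arc x y).
Proof.
by move=> exy; apply: connected_continuous_connected; [exact: segment_connected|exact: arc_continuous].
Qed.

Lemma arc_piece x y : e x y -> piece x y = arc x y.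
Proof.
move=> exy; rewrite /piece exy; case: eqVneq => // xy.
by rewrite xy e_irr in exy.
Qed.

Lemma arc_left x y : e x y -> arc x y (pos D x).
Proof. by move=> exy; exists 0; [rewrite /= in_itv /= lexx ler01|exact: arc_start]. Qed.

Lemma arc_right x y : e x y -> arc x y (pos D y).
Proof. by move=> exy; exists 1; [rewrite /= in_itv /= lexx ler01|exact: arc_end]. Qed.

Lemma pieceP x y p : piece x y p ->
  (exists2 w, w \in [:: x; y] & p = pos D w) \/
  (e x y /\ exists2 s, s \in `]0, 1[ & p = edge_arc D x y s).
Proof.
rewrite /piece; case: ifP => _; first by move=> ->; left; exists x; rewrite ?inE ?eqxx.
case: ifP => // exy [s]; rewrite /= in_itv /= => /andP[s0 s1] <-.
have [->|sn0] := eqVneq s 0; first by left; exists x; rewrite ?inE ?eqxx ?arc_start.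
have [->|sn1] := eqVneq s 1; first by left; exists y; rewrite ?inE ?eqxx ?orbT ?arc_end.
right; split=> //; exists s => //.
by rewrite in_itv /= !lt_neqAle eq_sym sn0 s0 sn1 s1.
Qed.

Lemma piece_disjoint x y x' y' : ~~ has (mem [:: x; y]) [:: x'; y'] ->
  piece x y `&` piece x' y' = set0.
Proof.
move=> dis; rewrite -subset0 => p [].
case/pieceP=> [[w wxy ->]|[exy [s s01 ->]]]; case/pieceP => [[w' wxy' E]|[exy' [s' s01' E]]].
- by case/hasP: dis; exists w' => //; rewrite -(pos_inj E).
- exact: (arc_avoids_vertices exy' s01' (esym E)).
- exact: (arc_avoids_vertices exy s01 E).
- apply: (arc_disjoint exy exy' _ s01 s01' E); apply: contraNneq dis => E'.
  by apply/hasP; exists x' => /=; rewrite ?inE ?eqxx //; have := set21 x' y'; rewrite -E' !inE.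
Qed.

Lemma drawingE : drawing D = \bigcup_(xy in [set: T * T]) piece xy.1 xy.2.
Proof.
apply/seteqP; split=> p.
  case=> [[x _ <-]|[x [y [exy [s s01 <-]]]]].
    by exists (x, x) => //=; rewrite /piece eqxx.
  by exists (x, y) => //=; rewrite arc_piece //; exists s.
case=> -[x y] _ /= /pieceP[[w _ ->]|[exy [s s01 ->]]]; first by left; exists w.
by right; exists x, y; split=> //; exists s => //; apply: subset_itv_oo_cc.
Qed.

Lemma closed_piece x y : closed (piece x y).
Proof. by apply: compact_closed_plane; apply: compact_piece. Qed.

Lemma outer_spoke F z v : F = connected_component (~` drawing D) z -> F z ->
  boundary F (pos D v) ->
  exists K, [/\ compact K, connected K, K z, K (pos D v) &
    forall x y, v \notin [:: x; y] -> K `&` piece x y = set0].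
Proof.
move=> FE Fz [clF _].
pose O := \bigcap_(xy in [set xy : T * T | v \notin [:: xy.1; xy.2]]) ~` piece xy.1 xy.2.
have oO : open O.
  rewrite /O -setC_bigcup; apply: closed_openC; apply: closed_bigcup => [|[x y] _]; first exact: finite_finset.
  exact: closed_piece.
have Ov : O (pos D v).
  move=> -[x y] /= vxy /pieceP[[w wxy /pos_inj vw]|[exy [s s01 E]]].
    by rewrite vw wxy in vxy.
  exact: (arc_avoids_vertices exy s01 (esym E)).
have [d d0 dO] := open_close oO Ov.
have [|q [Fq /closeP vq]] := clF (ball (pos D v) d); first exact: nbhsx_ballx.
have FO : F `<=` O.
  rewrite FE => p /connected_component_sub Fp [x y] /= _ pxy; apply: Fp.
  by rewrite drawingE; exists (x, y).
have [K [cK nK KO Kz Kv]] : joined O z (pos D v).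
  apply: joined_trans (_ : joined O z q) (joined_sym (joined_segment _)).
    by apply: (connected_joined oO FO) => //; rewrite FE; exact: component_connected.
  by move=> p /(segment_close vq); apply: dO.
exists K; split=> // x y vxy; rewrite -subset0 => p [Kp pxy].
exact: (KO p Kp (x, y) vxy).
Qed.

Definition pieces (A : {set T}) : set (R * R) :=
  [set p | exists x y, [/\ x \in A, y \in A & piece x y p]].

Lemma connect_linked d (A : {set T}) x y : 0 < d -> connect (edges_in e A) x y ->
  linked d (pieces A) (pos D x) (pos D y).
Proof.
move=> d0 /connectP[s + ->]; elim: s x => [|z s IH] x /=; first by exists [::].
case/andP=> /and3P[exz xA zA] /IH; apply: linked_trans.
apply: linked_sub (connected_linked d0 (connected_arc exz) (arc_left exz) (arc_right exz)).
by move=> p xzp; exists x, z; split=> //; rewrite arc_piece.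
Qed.

Lemma connect_edges_in_mem_left (A : {set T}) x y :
  x != y -> connect (edges_in e A) x y -> x \in A.
Proof.
move=> xy /connectP[[|z s]] /=; first by move=> _ yx; rewrite yx eqxx in xy.
by case/andP=> /and3P[].
Qed.

Lemma weak_K4_not_outer F : is_face D F -> (forall x, boundary F (pos D x)) -> ~ weak_K4 e.
Proof.
move=> [z Oz FE] bF [B [r [rB Bdis Bcon]]].
have Fz : F z by rewrite FE; exact: connected_component_refl.
have /choice[K HK] := fun v => outer_spoke FE Fz (bF v).
pose apart (A C : set (R * R)) d := forall p q, A p -> C q -> ~~ close (3 * d) p q.
have pieces_apart (xy xy' : T * T) : \forall d \near (0 : R)^'+,
    ~~ has (mem [:: xy.1; xy.2]) [:: xy'.1; xy'.2] ->
    apart (piece xy.1 xy.2) (piece xy'.1 xy'.2) d.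
  have [_|dis] := boolP (has _ _); first exact: filterE.
  have := compact_apart (@compact_piece xy.1 xy.2) (@compact_piece xy'.1 xy'.2) (piece_disjoint dis).
  by apply: filterS => d H _.
have spoke_apart v (xy : T * T) : \forall d \near (0 : R)^'+,
    v \notin [:: xy.1; xy.2] -> apart (K v) (piece xy.1 xy.2) d.
  have [_|dis] := boolP (v \in _); first exact: filterE.
  have [cK _ _ _ /(_ _ _ dis) Kb] := HK v.
  by have := compact_apart cK (@compact_piece xy.1 xy.2) Kb; apply: filterS => d H _.
have [d [d0 [apartP apartK]]] : exists d : R, 0 < d /\
    ((forall xy xy' : T * T, ~~ has (mem [:: xy.1; xy.2]) [:: xy'.1; xy'.2] ->
      apart (piece xy.1 xy.2) (piece xy'.1 xy'.2) d) /\
    (forall v (xy : T * T), v \notin [:: xy.1; xy.2] -> apart (K v) (piece xy.1 xy.2) d)).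
  apply: (@filter_ex _ (0 : R)^'+); apply: filterI; first exact: nbhs_right_gt.
  apply: filterI.
    exact: (filter_forall _ (fun xy => filter_forall _ (pieces_apart xy))).
  exact: (filter_forall _ (fun v => filter_forall _ (spoke_apart v))).
pose o n : 'I_4 := inord n; pose x n := r (o n).
have o_inj i j : (i < 4)%N -> (j < 4)%N -> i != j -> o i != o j.
  by move=> i4 j4; apply: contraNneq => /(congr1 val); rewrite /= !inordK // => ->.
have x_inj i j : (i < 4)%N -> (j < 4)%N -> i != j -> x i \notin B (o j).
  move=> i4 j4 ij; apply/negP => xB.
  by have /pred0P/(_ (x i)) := Bdis _ _ (o_inj i j i4 j4 ij); rewrite /= rB xB.
pose U i j := if j == 4 then K (x i) else pieces (B (o i) :|: B (o j))%SET.
pose P n := if n == 4 then z else pos D (x n).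
have UL i j : (i < j < 5)%N -> U i j (P i) /\ linked d (U i j) (P i) (P j).
  move=> /andP[ij j5]; have i4 : (i < 4)%N by lia.
  rewrite /U /P (_ : (i == 4) = false); last by lia.
  have [j4|j4] := eqVneq j 4.
    have [_ cK Kz Kx _] := HK (x i); split=> //; exact: connected_linked.
  have con : connect (edges_in e (B (o i) :|: B (o j))) (x i) (x j).
    by apply/Bcon/o_inj; lia.
  split; last exact: connect_linked.
  have xij : x i != x j.
    by apply: contraTneq (rB (o j)) => /= E; rewrite -/(x j) -E x_inj //; lia.
  have xA := connect_edges_in_mem_left xij con.
  by exists (x i), (x i); split=> //; rewrite /piece eqxx.
have /choice[L HL] : forall ij : nat * nat, exists s, (ij.1 < ij.2 < 5)%N ->
    [/\ path (close d) (P ij.1) s, last (P ij.1) s = P ij.2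
      & forall p, p \in P ij.1 :: s -> U ij.1 ij.2 p].
  move=> [i j] /=; have [ij|] := boolP (i < j < 5)%N; last by exists [::].
  have [Ui [s [ps ls sU]]] := UL i j ij; exists s => _; split=> // p.
  by rewrite inE => /orP[/eqP->|/sU].
have sepU i j k l : (i < j < 5)%N -> (k < l < 5)%N -> (i < k)%N -> uniq [:: i; j; k; l] ->
    forall p q, U i j p -> U k l q -> ~~ close (3 * d) p q.
  move=> /andP[ij j5] /andP[kl l5] ik; rewrite /= !inE !negb_or !andbT.
  move=> /and3P[/and3P[nij nik nil] /andP[njk njl] nkl] p q; rewrite /U.
  have notin a b c : (a < 4)%N -> (b < 4)%N -> (c < 4)%N -> a != b -> a != c ->
      forall u v, u \in (B (o b) :|: B (o c))%SET -> v \in (B (o b) :|: B (o c))%SET ->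
      x a \notin [:: u; v].
    move=> a4 b4 c4 ab ac u v; rewrite !inE => uB vB.
    have := x_inj a b a4 b4 ab; have := x_inj a c a4 c4 ac.
    move=> xc xb; apply/negP => /orP[/eqP E|/eqP E]; move: xc xb; rewrite E.
      by case/orP: uB => ->.
    by case/orP: vB => ->.
  have [j4|j4] := eqVneq j 4.
    have -> : (l == 4) = false by lia.
    move=> Kp [u [v [uB vB uvq]]]; apply: (apartK (x i) (u, v)) => //=.
    by apply: (notin i k l) => //; lia.
  have [l4|l4] := eqVneq l 4.
    move=> [u [v [uB vB uvp]]] Kq; rewrite close_sym; apply: (apartK (x k) (u, v)) => //=.
    by apply: (notin k i j) => //; lia.
  move=> [u [v [uB vB uvp]]] [u' [v' [uB' vB' uvq]]].
  have dis a b w : (a < 4)%N -> (b < 4)%N -> a != b -> w \in B (o a) -> w \in B (o b) -> False.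
    move=> a4 b4 ab wa wb.
    by have /pred0P/(_ w) := Bdis _ _ (o_inj a b a4 b4 ab); rewrite /= wa wb.
  have dis2 w : w \in (B (o i) :|: B (o j))%SET -> w \in (B (o k) :|: B (o l))%SET -> False.
    by rewrite !inE => /orP[] wa /orP[] wb;
      [apply: (dis i k w)|apply: (dis i l w)|apply: (dis j k w)|apply: (dis j l w)] => //; lia.
  apply: (apartP (u, v) (u', v') _ p q uvp uvq); apply/hasPn => w.
  rewrite inE /= inE => wkl; apply/negP; rewrite inE /= inE => wij.
  by apply: (dis2 w); [case/orP: wij => /eqP-> | case/orP: wkl => /eqP->].
apply: (@van_kampen_flores_chains R d P (fun i j => L (i, j)) d0).
  by move=> i j ij; have [] := HL (i, j) ij.
move=> i j k l ij kl ik u; have [_ _ Up] := HL (i, j) ij; have [_ _ Uq] := HL (k, l) kl.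
apply/allP=> p ps; apply/allP=> q qs.
exact: (sepU i j k l ij kl ik u p q (Up p ps) (Uq q qs)).
Qed.

End Drawing.

Lemma outerplanar_no_weak_K4 (R : realType) (T : finType) (e : rel T) :
  irreflexive e -> outerplanar R e -> ~ weak_K4 e.
Proof. by move=> e_irr [D [F [FF _ bF]]]; apply: (weak_K4_not_outer e_irr FF bF). Qed.

Theorem theorem6 (R : realType) (T : finType) (e : rel T)
    (e_sym : symmetric e) (e_irr : irreflexive e)
    (e_maxop : maximal_outerplanar R e) :
  ((domination_number e)%:R : R) <=
    Num.min (3 * (packing_number e)%:R)
            (9 / 4 * (packing_number e)%:R
             + (#|[set x : T | (degree e x <= 3)%N]%SET|)%:R / 4).
Proof.
have [s [_ sT ns]] : exists s, [/\ uniq s, s =i [set: T]%SET & narrow e s].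
  apply: narrow_order => //.
  by apply: (outerplanar_no_weak_K4 (R := R)) => //; case: e_maxop.
have : (domination_number e <= 2 * packing_number e)%N.
  by apply: (domination_le_2packing e_sym _ ns) => x; rewrite sT inE.
rewrite -(ler_nat R) natrM => le2.
set t := #|_|.
have rho0 : 0 <= (packing_number e)%:R :> R by [].
have t0 : 0 <= t%:R :> R by [].
by rewrite le_min; apply/andP; split; lra.
Qed.
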